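(* Let $n$ be a nonnegative integer and let $a,c$ be complex numbers such that no lower parameter of the series below is a nonpositive integer and all denominators below are nonzero. Then $$\frac{(c-a)_n}{(c)_n}={}_4F_3\left[\begin{matrix}-\frac n2,\ \frac{1-n}{2},\ a,\ 1-a\\ \frac12,\ c,\ 1-c-n\end{matrix};1\right]+\frac{na}{1-c-n}\;{}_4F_3\left[\begin{matrix}\frac{1-n}{2},\ \frac{2-n}{2},\ 1+a,\ 1-a\\ \frac32,\ c,\ 2-c-n\end{matrix};1\right].$$
   Context: $(x)_0=1$ and $(x)_n=x(x+1)\cdots(x+n-1)$ for $n\ge1$. The generalized hypergeometric series is ${}_pF_q\left[\begin{matrix}a_1,\dots,a_p\\ b_1,\dots,b_q\end{matrix};z\right]=\sum_{k\ge0}\frac{(a_1)_k\cdots(a_p)_k}{(b_1)_k\cdots(b_q)_k}\frac{z^k}{k!}$, with lower parameters $b_j\in\mathbb{C}\setminus\mathbb{Z}_{\le0}$. The series involved terminate; a term whose coefficient vanishes because of the factor $n$ (when $n=0$) is read as $0$. *)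

(* Defs.v *)
From HB Require Import structures.
From mathcomp Require Import all_boot all_order all_algebra.
From mathcomp Require Import all_classical all_reals all_analysis.
From mathcomp Require Export complex.
Set Implicit Arguments.
Unset Strict Implicit.
Unset Printing Implicit Defensive.
Import Order.TTheory GRing.Theory Num.Theory.
Import numFieldNormedType.Exports.
Local Open Scope classical_set_scope.
Local Open Scope ring_scope.

Definition pochhammer (K : numFieldType) (x : K) (n : nat) : K :=
  \prod_(i < n) (x + i%:R).

Definition hypergeometric_term (K : numFieldType) (us ls : seq K) (z : K)
    (k : nat) : K :=
  (\prod_(u <- us) pochhammer u k) / (\prod_(l <- ls) pochhammer l k)
  * (z ^+ k / k`!%:R).

(* The upper parameters are [us], the lower ones [ls].  The limit is total: if
   the series diverges its value is an unspecified element of [K]. *)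
Definition hypergeometric (K : numFieldType) (us ls : seq K) (z : K) : K :=
  limn (series (hypergeometric_term us ls z)).

Definition admissible_lower (K : numFieldType) (ls : seq K) : Prop :=
  forall l, l \in ls -> forall k : nat, l != - k%:R.

(* Main.v *)
Require Import Defs.
From mathcomp Require Import all_boot all_order all_algebra.
From mathcomp Require Import all_classical all_reals all_analysis.
From mathcomp Require Import ring zify.
Set Implicit Arguments.
Unset Strict Implicit.
Import Order.TTheory GRing.Theory Num.Theory.
Import numFieldNormedType.Exports.
Local Open Scope ring_scope.

(** Multiplied by [(c)_n], the [k]-th terms of the two summands (the factor in
    front of the second series included) become the terms [m = 2k] and
    [m = 2k+1] of one polynomial sum.  Indeed the duplication
    formula [(x/2)_k ((x+1)/2)_k 4^k = (x)_(2k)] turns the pairs of half-integer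
    parameters into the binomial coefficients [C(n, 2k)] and [C(n, 2k+1)], and
    the reflection [(1-x)_k = (-1)^k (x-k)_k] turns [1-a], [1-c-n] and [2-c-n]
    into factors that extend [(a)_k] to [(a-k)_(2k)], respectively
    [(a-k)_(2k+1)], and cancel both ends of [(c)_n].  What has to be shown is

      [(c-a)_n = sum_m (-1)^m C(n, m) (a - m/2)_m (c + m/2)_(n-m)]

    where [m/2] is rounded down.

    This sum [S_n(a, c)] satisfies [S_(n+1)(a, c) = (c-a) S_n(a, c+1)], the
    recurrence of [(c-a)_n].  To see it, group the terms [m = 2k] and
    [m = 2k+1].  By Pascal's rule and [(m+1) C(n, m+1) = (n-m) C(n, m)] the
    difference of the two sides has [k]-th term [B_k - B_(k+1)], where [B_k] is
    the [C(n, 2k-1)] half of the term [m = 2k] of [S_(n+1)(a, c)]; it telescopes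
    to [0] ([paired_terms_telescope], [paired_sum]).

    The [k]-th terms carry the factors [C(n, 2k)] and [C(n, 2k+1)], so the
    series terminate and their limits are finite sums.  For [n = 0] this
    argument does not reach the second series, but its factor is then [0]. *)

(** * Pochhammer symbols *)

Section Pochhammer.
Variable K : numFieldType.
Implicit Types (x : K) (m n k : nat).

Lemma pochhammer0 x : pochhammer x 0 = 1.
Proof. by rewrite /pochhammer big_ord0. Qed.

Lemma pochhammerSr x n : pochhammer x n.+1 = pochhammer x n * (x + n%:R).
Proof. by rewrite /pochhammer big_ord_recr. Qed.

Lemma pochhammerSl x n : pochhammer x n.+1 = x * pochhammer (x + 1) n.
Proof.
rewrite /pochhammer big_ord_recl addr0; congr (_ * _).
by apply: eq_bigr => i _; rewrite /bump /= natrD addrA.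
Qed.

Lemma pochhammerD x m n :
  pochhammer x (m + n) = pochhammer x m * pochhammer (x + m%:R) n.
Proof.
elim: n => [|n IHn]; first by rewrite addn0 pochhammer0 mulr1.
by rewrite addnS !pochhammerSr IHn natrD -mulrA addrA.
Qed.

Lemma pochhammer_reflect x k :
  pochhammer (1 - x) k = (-1) ^+ k * pochhammer (x - k%:R) k.
Proof.
elim: k => [|k IHk]; first by rewrite !pochhammer0 mulr1.
rewrite pochhammerSr IHk pochhammerSl exprS.
rewrite (_ : x - k.+1%:R + 1 = x - k%:R); first by ring.
by ring.
Qed.

Lemma pochhammer_duplication x k :
  pochhammer (x / 2) k * pochhammer ((x + 1) / 2) k * 4 ^+ k
  = pochhammer x k.*2.
Proof.
elim: k => [|k IHk]; first by rewrite !pochhammer0 !mulr1.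
by rewrite doubleS !pochhammerSr -IHk exprS -addnn; field.
Qed.

Lemma pochhammer_opp_nat n k :
  pochhammer (- n%:R : K) k = (-1) ^+ k * (n ^_ k)%:R.
Proof.
elim: k => [|k IHk]; first by rewrite pochhammer0 mul1r.
rewrite pochhammerSr IHk ffactnSr natrM.
have [le_kn|lt_nk] := leqP k n; last by rewrite ffact_small //; ring.
by rewrite natrB // exprS; ring.
Qed.

Lemma pochhammer1 k : pochhammer (1 : K) k = k`!%:R.
Proof.
elim: k => [|k IHk]; first by rewrite pochhammer0.
by rewrite pochhammerSr IHk factS natrM; ring.
Qed.

Lemma pochhammer2 k : pochhammer (2 : K) k = k.+1`!%:R.
Proof. by rewrite -pochhammer1 pochhammerSl mul1r. Qed.

Lemma expr4_neq0 k : 4 ^+ k != 0 :> K.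
Proof. by rewrite expf_neq0 // pnatr_eq0. Qed.

(** The duplication formula at [- n] and at [1], divided by one another. *)
Lemma pochhammer_half_even n k :
  pochhammer (- (n%:R / 2) : K) k * pochhammer ((1 - n%:R) / 2) k
  = 'C(n, k.*2)%:R * (pochhammer (1 / 2) k * k`!%:R).
Proof.
apply: (mulIf (expr4_neq0 k)).
have := pochhammer_duplication (- n%:R) k.
rewrite mulNr [- _ + 1]addrC => ->.
rewrite -mulrA -pochhammer1.
have /= := pochhammer_duplication 1 k.
rewrite (_ : (1 + 1) / 2 = 1 :> K) => [->|]; last by field.
by rewrite pochhammer1 pochhammer_opp_nat -natrM bin_ffact -mul2n exprM sqrrN
  !expr1n mul1r.
Qed.

(** The duplication formula at [- n] and at [2], divided by one another. *)
Lemma pochhammer_half_odd n k :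
  n.+1%:R * (pochhammer ((1 - n.+1%:R) / 2 : K) k
             * pochhammer ((2 - n.+1%:R) / 2) k)
  = 'C(n.+1, k.*2.+1)%:R * (pochhammer (3 / 2) k * k`!%:R).
Proof.
apply: (mulIf (expr4_neq0 k)).
have := pochhammer_duplication (- n%:R) k.
rewrite (_ : - n%:R = 1 - n.+1%:R); last by ring.
rewrite (_ : 1 - n.+1%:R + 1 = 2 - n.+1%:R); last by ring.
move=> dupl; rewrite -mulrA dupl -mulrA -pochhammer1.
rewrite (_ : 1 - n.+1%:R = - n%:R :> K); last by ring.
have := pochhammer_duplication 2 k.
rewrite divff ?pnatr_eq0 // (_ : 2 + 1 = 3); last by ring.
rewrite [pochhammer 1 k * _]mulrC => ->.
rewrite pochhammer2 pochhammer_opp_nat -natrM bin_ffact -mul2n exprM sqrrN.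
by rewrite !expr1n mul1r -natrM ffactnS.
Qed.

Lemma pochhammer_neq0 (ls : seq K) l k :
  admissible_lower ls -> l \in ls -> pochhammer l k != 0.
Proof.
move=> ls_ok /ls_ok l_ok; apply/prodf_neq0 => i _.
by rewrite addr_eq0.
Qed.

End Pochhammer.

(** * The polynomial identity *)

Section PolynomialIdentity.
Variable K : numFieldType.
Implicit Types (a c : K) (n k : nat).

Definition even_term n a c k : K :=
  'C(n, k.*2)%:R * pochhammer (a - k%:R) k.*2
  * pochhammer (c + k%:R) (n - k.*2).

Definition odd_term n a c k : K :=
  'C(n, k.*2.+1)%:R * pochhammer (a - k%:R) k.*2.+1
  * pochhammer (c + k%:R) (n - k.*2.+1).

(** The difference of binomials is [C(n, 2k-1)], in a form that also makes
    sense, and vanishes, at [k = 0]. *)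
Definition pascal_part n a c k : K :=
  ('C(n.+1, k.*2)%:R - 'C(n, k.*2)%:R) * pochhammer (a - k%:R) k.*2
  * pochhammer (c + k%:R) (n.+1 - k.*2).

(** For [n = 2k + 1 + j] all products are multiples of
    [(a-k)_(2k) (c+k+1)_j], and what remains is the relation
    [(2k+1) C(n, 2k+1) = (j+1) C(n, 2k)]. *)
Lemma paired_terms_telescope n a c k :
  even_term n.+1 a c k - odd_term n.+1 a c k
  = (c - a) * (even_term n a (c + 1) k - odd_term n a (c + 1) k)
    + (pascal_part n a c k - pascal_part n a c k.+1).
Proof.
rewrite /even_term /odd_term /pascal_part doubleS !binS !natrD.
have [lt_nk|le_kn] := ltnP n k.*2.
  by rewrite (@bin_small n k.*2) ?(@bin_small n k.*2.+1) //; [ring | lia].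
have [j def_n] : exists j, n = (k.*2 + j)%N.
  by exists (n - k.*2)%N; rewrite subnKC.
case: j => [|j] in def_n *.
  rewrite def_n addn0 subSnn !subnn.
  rewrite [in 'C(k.*2, k.*2.+1)]bin_small // binn.
  by rewrite !pochhammerSr !pochhammer0 -addnn; ring.
have -> : (n.+1 - k.*2 = j.+2)%N by lia.
have -> : (n.+1 - k.*2.+1 = j.+1)%N by lia.
have -> : (n - k.*2 = j.+1)%N by lia.
have -> : (n - k.*2.+1 = j)%N by lia.
have -> : (n.+1 - k.*2.+2 = j)%N by lia.
have bin_rel : (k.*2.+1)%:R * 'C(n, k.*2.+1)%:R = j.+1%:R * 'C(n, k.*2)%:R :> K.
  by rewrite -!natrM mul_bin_left; congr (_ * _)%:R; lia.
rewrite (pochhammerSl (a - k.+1%:R)) (_ : a - k.+1%:R + 1 = a - k%:R);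
  last by ring.
rewrite !(pochhammerSr (a - k%:R)) (pochhammerSl (c + k%:R)).
rewrite (pochhammerSl (c + k%:R) j) (_ : c + k%:R + 1 = c + 1 + k%:R);
  last by ring.
rewrite (_ : c + k.+1%:R = c + 1 + k%:R); last by ring.
rewrite (pochhammerSr (c + 1 + k%:R)).
set P := pochhammer (a - k%:R) _; set Q := pochhammer (c + 1 + k%:R) j.
apply/eqP; rewrite -subr_eq0; apply/eqP.
transitivity (P * (a + k%:R) * Q *
  (j.+1%:R * 'C(n, k.*2)%:R - (k.*2.+1)%:R * 'C(n, k.*2.+1)%:R)).
  by rewrite -addnn; ring.
by rewrite bin_rel subrr mulr0.
Qed.

(** The terms with [2k > n] vanish; keeping the bound [N] independent of [n]
    makes the recurrence a relation between sums over the same range. *)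
Lemma paired_sum n N a c : (n < N)%N ->
  \sum_(0 <= k < N) (even_term n a c k - odd_term n a c k)
  = pochhammer (c - a) n.
Proof.
elim: n c => [|n IHn] c lt_nN.
  rewrite big_ltn // big_nat big1 => [|[//|k] _].
    rewrite /even_term /odd_term bin0 bin_small // !pochhammer0; ring.
  by rewrite /even_term /odd_term !bin_small //; ring.
rewrite (eq_bigr _ (fun k _ => paired_terms_telescope n a c k)).
rewrite big_split /= -mulr_sumr IHn; last exact: ltnW.
rewrite pochhammerSl (_ : c + 1 - a = c - a + 1); last by ring.
rewrite (eq_bigr (fun k => - pascal_part n a c k.+1 - - pascal_part n a c k));
  last by move=> k _; ring.
rewrite telescope_sumr // /pascal_part !bin0 !bin_small; [ring | lia | lia].
Qed.

End PolynomialIdentity.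

(** * From the series to the polynomial terms *)

Section Series.
Variable K : numFieldType.
Implicit Types (a c z : K) (us ls : seq K) (n k : nat).

Lemma hypergeometric_terminating us ls z N :
  (forall k, (N <= k)%N -> hypergeometric_term us ls z k = 0) ->
  hypergeometric us ls z = \sum_(0 <= k < N) hypergeometric_term us ls z k.
Proof.
move=> term0; apply: (@cvg_lim K) => //.
apply: cvg_near_cst; exists N => // m /= le_Nm.
rewrite seriesEnat /= (big_cat_nat _ le_Nm) //= -[RHS]addr0; congr (_ + _).
by rewrite big_nat big1 // => k /andP[le_Nk _]; apply: term0.
Qed.

Lemma hypergeometric_term_even n a c k :
  hypergeometric_term [:: - (n%:R / 2); (1 - n%:R) / 2; a; 1 - a]
    [:: 1 / 2; c; 1 - c - n%:R] 1 k
  = 'C(n, k.*2)%:R * (pochhammer (1 / 2) k * k`!%:R)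
    * (pochhammer a k * pochhammer (1 - a) k)
    / (pochhammer (1 / 2) k
       * (pochhammer c k * pochhammer (1 - c - n%:R) k)) / k`!%:R.
Proof.
rewrite /hypergeometric_term !big_cons !big_nil !mulr1 expr1n.
by rewrite [1 / k`!%:R]div1r -pochhammer_half_even !mulrA.
Qed.

Lemma hypergeometric_term_odd n a c k :
  n.+1%:R *
  hypergeometric_term [:: (1 - n.+1%:R) / 2; (2 - n.+1%:R) / 2; 1 + a; 1 - a]
    [:: 3 / 2; c; 2 - c - n.+1%:R] 1 k
  = 'C(n.+1, k.*2.+1)%:R * (pochhammer (3 / 2) k * k`!%:R)
    * (pochhammer (1 + a) k * pochhammer (1 - a) k)
    / (pochhammer (3 / 2) k
       * (pochhammer c k * pochhammer (2 - c - n.+1%:R) k)) / k`!%:R.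
Proof.
rewrite /hypergeometric_term !big_cons !big_nil !mulr1 expr1n.
by rewrite [1 / k`!%:R]div1r -pochhammer_half_odd !mulrA.
Qed.

(** The reflected symbol [(c+n-k)_k] and [(c)_k] are the two ends of [(c)_n];
    cancelling them leaves [(c+k)_(n-2k)].  The two signs [(-1)^k] coming from
    [1-a] and [1-c-n] cancel as well. *)
Lemma hypergeometric_term_even_poly n a c k :
    admissible_lower [:: 1 / 2; c; 1 - c - n%:R] ->
  pochhammer c n *
  hypergeometric_term [:: - (n%:R / 2); (1 - n%:R) / 2; a; 1 - a]
    [:: 1 / 2; c; 1 - c - n%:R] 1 k
  = even_term n a c k.
Proof.
move=> ok; rewrite hypergeometric_term_even /even_term.
have [lt_nk|le_kn] := ltnP n k.*2; first by rewrite bin_small // !(mul0r, mulr0).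
have h0 : pochhammer (1 / 2 : K) k != 0.
  by apply: pochhammer_neq0 ok _; rewrite !inE eqxx.
have c0 : pochhammer c k != 0.
  by apply: pochhammer_neq0 ok _; rewrite !inE eqxx orbT.
have : pochhammer (1 - c - n%:R) k != 0.
  by apply: pochhammer_neq0 ok _; rewrite !inE eqxx !orbT.
have f0 : k`!%:R != 0 :> K by rewrite pnatr_eq0 -lt0n fact_gt0.
have s0 : (-1) ^+ k != 0 :> K by rewrite signr_eq0.
rewrite (_ : 1 - c - n%:R = 1 - (c + n%:R)); last by ring.
rewrite !pochhammer_reflect mulf_eq0 negb_or => /andP[_ d0].
have -> : pochhammer c n = pochhammer c k
    * pochhammer (c + k%:R) (n - k.*2) * pochhammer (c + n%:R - k%:R) k.
  have {1}-> : n = (k + (n - k.*2) + k)%N by lia.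
  rewrite !pochhammerD; congr (_ * pochhammer _ _).
  by rewrite natrD natrB // -addnn; ring.
have -> : pochhammer (a - k%:R) k.*2
    = pochhammer (a - k%:R) k * pochhammer a k.
  by rewrite -addnn pochhammerD subrK.
by field; rewrite h0 c0 d0 f0 s0.
Qed.

(** Here the upper end of [(c)_(n+1)] that cancels has [k+1] factors: [k] come
    from the reflected parameter, and [c+n] is the opposite of the denominator
    in front of the series, which is the source of the sign. *)
Lemma hypergeometric_term_odd_poly n a c k :
    admissible_lower [:: 3 / 2; c; 2 - c - n.+1%:R] ->
    1 - c - n.+1%:R != 0 ->
  pochhammer c n.+1 * (n.+1%:R * a / (1 - c - n.+1%:R) *
  hypergeometric_term [:: (1 - n.+1%:R) / 2; (2 - n.+1%:R) / 2; 1 + a; 1 - a]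
    [:: 3 / 2; c; 2 - c - n.+1%:R] 1 k)
  = - odd_term n.+1 a c k.
Proof.
move=> ok den0; rewrite -[n.+1%:R * a]mulrC -[a * _ / _]mulrA.
rewrite [n.+1%:R / _]mulrC -!mulrA hypergeometric_term_odd /odd_term.
have [lt_nk|le_kn] := ltnP n.+1 k.*2.+1.
  by rewrite bin_small // !(mul0r, mulr0) oppr0.
have h0 : pochhammer (3 / 2 : K) k != 0.
  by apply: pochhammer_neq0 ok _; rewrite !inE eqxx.
have c0 : pochhammer c k != 0.
  by apply: pochhammer_neq0 ok _; rewrite !inE eqxx orbT.
have : pochhammer (2 - c - n.+1%:R) k != 0.
  by apply: pochhammer_neq0 ok _; rewrite !inE eqxx !orbT.
have f0 : k`!%:R != 0 :> K by rewrite pnatr_eq0 -lt0n fact_gt0.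
have s0 : (-1) ^+ k != 0 :> K by rewrite signr_eq0.
rewrite (_ : 2 - c - n.+1%:R = 1 - (c + n%:R)); last by ring.
rewrite !pochhammer_reflect mulf_eq0 negb_or => /andP[_ d0].
have -> : pochhammer c n.+1 = pochhammer c k
    * pochhammer (c + k%:R) (n.+1 - k.*2.+1)
    * pochhammer (c + n%:R - k%:R) k * (c + n%:R).
  rewrite pochhammerSr subSS; congr (_ * _).
  have {1}-> : n = (k + (n - k.*2) + k)%N by lia.
  rewrite !pochhammerD; congr (_ * pochhammer _ _).
  by rewrite natrD natrB // -addnn; ring.
have -> : pochhammer (a - k%:R) k.*2.+1
    = pochhammer (a - k%:R) k * (a * pochhammer (1 + a) k).
  by rewrite -addnn -addnS pochhammerD subrK pochhammerSl [a + 1]addrC.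
have e : 1 - c - n.+1%:R = - (c + n%:R) by ring.
rewrite e in den0 *; rewrite oppr_eq0 in den0.
by field; rewrite h0 c0 d0 f0 s0 den0.
Qed.

End Series.

(* For [n = 0] the second series need not converge; the second summand is then
   [0] because of its factor [n%:R], whatever value the series is given. *)
Theorem theorem3p1 (R : realType) (n : nat) (a c : R[i])
  (hlower1 : admissible_lower [:: 1 / 2; c; 1 - c - n%:R])
  (hlower2 : admissible_lower [:: 3 / 2; c; 2 - c - n%:R])
  (hcn : pochhammer c n != 0)
  (hden : 1 - c - n%:R != 0) :
  pochhammer (c - a) n / pochhammer c n =
    hypergeometric
      [:: - (n%:R / 2); (1 - n%:R) / 2; a; 1 - a]
      [:: 1 / 2; c; 1 - c - n%:R] 1
    + n%:R * a / (1 - c - n%:R) *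
      hypergeometric
        [:: (1 - n%:R) / 2; (2 - n%:R) / 2; 1 + a; 1 - a]
        [:: 3 / 2; c; 2 - c - n%:R] 1.
Proof.
apply: (mulfI hcn); rewrite mulrCA divff // mulr1 mulrDr.
rewrite -(paired_sum _ _ (ltnSn n)) big_split /=; congr (_ + _).
  rewrite (@hypergeometric_terminating _ _ _ _ n.+1) => [|k lt_nk].
    rewrite mulr_sumr; apply: eq_bigr => k _.
    by rewrite hypergeometric_term_even_poly.
  by rewrite hypergeometric_term_even bin_small ?mul0r //; lia.
case: n => [|n] in hlower2 hden hcn hlower1 *.
  rewrite !mul0r mulr0 big1 // => k _.
  by rewrite /odd_term bin_small // !mul0r oppr0.
rewrite (@hypergeometric_terminating _ _ _ _ n.+2) => [|k lt_nk].
  rewrite !mulr_sumr; apply: eq_bigr => k _.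
  by rewrite hypergeometric_term_odd_poly.
have n0 : n.+1%:R != 0 :> R[i] by rewrite pnatr_eq0.
apply: (mulfI n0); rewrite hypergeometric_term_odd bin_small ?mul0r ?mulr0 //.
by lia.
Qed.
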